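(* Let $A\in\mathbb{R}^{m\times n}$ and $1\le k\le\operatorname{rank}(A)$. Let $U_k\in\mathbb{R}^{m\times k}$ consist of $k$ dominant left singular vectors of $A$. Let $\hat U\in\mathbb{R}^{m\times k}$ (a perturbation of $U_k$) satisfy $\operatorname{rank}(\hat U)=k$ or $\|U_k-\hat U\|_2\le 1/2$, and let $\epsilon_U\equiv\|\hat U^{\dagger}\|_2\,\|U_k-\hat U\|_2$. Then for every Schatten $p$-norm $\|\cdot\|_{(p)}$, $$\|(I-U_kU_k^T)A\|_{(p)}\ \le\ \|(I-\hat U\hat U^{\dagger})A\|_{(p)}\ \le\ \|(I-U_kU_k^T)A\|_{(p)}+\epsilon_U\,\|A\|_{(p)}.$$
   Context: For a real matrix $M\in\mathbb{R}^{m\times n}$ with singular values $\sigma_1(M)\ge\dots\ge\sigma_r(M)\ge 0$, $r=\min\{m,n\}$, the Schatten $p$-norm is $\|M\|_{(p)}=\left(\sum_{j=1}^r\sigma_j(M)^p\right)^{1/p}$ for integers $p\ge1$, and $\|M\|_{(\infty)}=\|M\|_2=\sigma_1(M)$ for $p=\infty$. $M^{\dagger}$ denotes the Moore-Penrose inverse. ''$k$ dominant left singular vectors of $A$'' means the leading $k$ columns of $U$ in some full SVD $A=U\Sigma V^T$ ($U,V$ orthogonal, diagonal entries of $\Sigma$ being the singular values in non-increasing order); no singular value gap is assumed. *)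

(* Defs.v *)
From HB Require Import structures.
From mathcomp Require Import all_boot all_order all_algebra.
From mathcomp Require Import all_classical all_reals.
From mathcomp Require Import topology normedtype derive exp ring lra.

Set Implicit Arguments.
Unset Strict Implicit.
Unset Printing Implicit Defensive.
Import Order.TTheory GRing.Theory Num.Theory.
Import numFieldNormedType.Exports.
Local Open Scope classical_set_scope.
Local Open Scope ring_scope.

Section SquaredNorm.
Context {R : realType}.
Implicit Types m n : nat.

Definition sqnorm n (x : 'rV[R]_n) : R := (x *m x^T) 0 0.

Lemma sqnormE n (x : 'rV[R]_n) : sqnorm x = \sum_i x 0 i ^+ 2.
Proof. by rewrite /sqnorm mxE; apply: eq_bigr => i _; rewrite mxE expr2. Qed.

Lemma sqnorm_ge0 n (x : 'rV[R]_n) : 0 <= sqnorm x.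
Proof. by rewrite sqnormE sumr_ge0 // => i _; exact: sqr_ge0. Qed.

Lemma sqnorm_eq0 n (x : 'rV[R]_n) : sqnorm x = 0 -> x = 0.
Proof.
rewrite sqnormE => /psumr_eq0P H; apply/rowP => i; rewrite mxE.
by apply/eqP; rewrite -sqrf_eq0 H // => j _; exact: sqr_ge0.
Qed.

Lemma sqnormZ n a (x : 'rV[R]_n) : sqnorm (a *: x) = a ^+ 2 * sqnorm x.
Proof. by rewrite /sqnorm linearZ /= -scalemxAl -scalemxAr scalerA mxE expr2. Qed.

Lemma sqnormM m n (x : 'rV[R]_m) (Q : 'M[R]_(m, n)) :
  Q *m Q^T = 1%:M -> sqnorm (x *m Q) = sqnorm x.
Proof. by move=> QQ; rewrite /sqnorm trmx_mul mulmxA -(mulmxA x) QQ mulmx1. Qed.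

Lemma sqnorm_row_mx m n (x : 'rV[R]_m) (y : 'rV[R]_n) :
  sqnorm (row_mx x y) = sqnorm x + sqnorm y.
Proof. by rewrite /sqnorm tr_row_mx mul_row_col mxE. Qed.

Lemma sqnorm_scalar (a : R) : sqnorm (a%:M : 'rV_1) = a ^+ 2.
Proof. by rewrite sqnormE big_ord1 mxE eqxx mulr1n. Qed.

Lemma sqnorm_delta n : sqnorm (delta_mx 0 0 : 'rV[R]_n.+1) = 1.
Proof.
rewrite sqnormE (bigD1 ord0) //= !mxE !eqxx expr1n big1 ?addr0 // => i i0.
by rewrite mxE (negPf i0) andbF expr0n.
Qed.

Lemma sqnorm_normalize n (x : 'rV[R]_n.+1) :
  exists2 v, sqnorm v = 1 & x = Num.sqrt (sqnorm x) *: v.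
Proof.
have [x0|x0] := eqVneq (sqnorm x) 0.
  exists (delta_mx 0 0); first exact: sqnorm_delta.
  by rewrite x0 sqrtr0 scale0r (sqnorm_eq0 x0).
have s0 : Num.sqrt (sqnorm x) != 0.
  by rewrite sqrtr_eq0 -ltNge lt_def x0 sqnorm_ge0.
exists ((Num.sqrt (sqnorm x))^-1 *: x); last by rewrite scalerA mulfV ?scale1r.
by rewrite sqnormZ exprVn sqr_sqrtr ?sqnorm_ge0 // mulVf.
Qed.

Lemma continuous_sumr (T : topologicalType) n (F : 'I_n -> T -> R) :
  (forall i, continuous (F i)) -> continuous (fun x => \sum_i F i x).
Proof.
move=> cF; apply: continuous_big => [|i _]; [exact: add_continuous|exact: cF].
Qed.

Lemma continuous_sqnormM m n (M : 'M[R]_(m, n)) :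
  continuous (fun x : 'rV[R]_m => sqnorm (x *m M)).
Proof.
rewrite (_ : (fun x : 'rV[R]_m => sqnorm (x *m M)) =
  (fun x : 'rV[R]_m => \sum_j (\sum_i x 0 i * M i j) * (\sum_i x 0 i * M i j))); last first.
  by apply/funext => x; rewrite sqnormE; apply: eq_bigr => j _; rewrite mxE expr2.
have cf j : continuous (fun x : 'rV[R]_m => \sum_i x 0 i * M i j).
  apply: continuous_sumr => i x.
  exact: (cvgM (@coord_continuous R 1 m 0 i x) (cvg_cst (M i j))).
apply: continuous_sumr => j x.
exact: (cvgM (cf j x) (cf j x)).
Qed.

Lemma compact_unit_sphere n : compact [set x : 'rV[R]_n | sqnorm x = 1].
Proof.
apply: bounded_closed_compact.
  exists 1; split => // M M1 x /= x1; apply: le_trans (ltW M1).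
  rewrite [leLHS]/Num.norm /= mx_normrE; apply/bigmax_leP; split=> // -[i j] _ /=.
  rewrite (ord1 i) -(@ler_pXn2r _ 2) ?nnegrE // expr1n real_normK ?num_real //.
  rewrite -x1 sqnormE (bigD1 j) //= lerDl sumr_ge0 // => l _.
  exact: sqr_ge0.
rewrite (_ : [set _ | _] = (fun x : 'rV[R]_n => sqnorm (x *m 1%:M)) @^-1` [set 1]).
  apply: preimage_closed; last exact: closed_eq.
  by move=> x _; exact: continuous_sqnormM.
by apply/seteqP; split => x /=; rewrite mulmx1.
Qed.

Lemma exists_max_sqnormM m n (M : 'M[R]_(m.+1, n)) :
  exists2 u, sqnorm u = 1 &
    forall x, sqnorm (x *m M) <= sqnorm (u *m M) * sqnorm x.
Proof.
have [||u] := compact_EVT_max (f := fun x : 'rV[R]_m.+1 => sqnorm (x *m M))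
    _ (@compact_unit_sphere m.+1).
- by exists (delta_mx 0 0); exact: sqnorm_delta.
- by apply: continuous_subspaceT; exact: continuous_sqnormM.
rewrite inE /= => u1 umax; exists u => // x.
have [v v1 {1}->] := sqnorm_normalize x.
rewrite -scalemxAl sqnormZ sqr_sqrtr ?sqnorm_ge0 // mulrC.
by rewrite ler_wpM2r ?sqnorm_ge0 // umax // inE.
Qed.

(* The Householder reflection exchanging [v] and the first unit vector. *)
Lemma orthogonal_completion n (v : 'rV[R]_n.+1) : sqnorm v = 1 ->
  exists2 Q : 'M[R]_n.+1, Q *m Q^T = 1%:M & delta_mx 0 0 *m Q = v.
Proof.
move=> v1; pose e : 'rV[R]_n.+1 := delta_mx 0 0.
have [w wE] : exists w, w = v - e by exists (v - e).
have [w0|w0] := eqVneq (sqnorm w) 0.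
  exists 1%:M; first by rewrite trmx1 mulmx1.
  by rewrite mulmx1; apply/esym/eqP; rewrite -subr_eq0 -/e -wE (sqnorm_eq0 w0).
pose c := 2 / sqnorm w.
have wwT : w *m w^T = (sqnorm w)%:M by rewrite {1}[w *m _]mx11_scalar.
have mxB (X Y : 'M[R]_1) : (X - Y) 0 0 = X 0 0 - Y 0 0 by rewrite !mxE.
have ewT : e *m w^T = (- sqnorm w / 2)%:M.
  rewrite [e *m _]mx11_scalar; congr (_%:M).
  have -> : sqnorm w = sqnorm v - (v *m e^T) 0 0 - (e *m v^T) 0 0 + sqnorm e.
    rewrite /sqnorm wE linearB /= mulmxBl !mulmxBr.
    by rewrite !mxB; ring.
  have -> : (e *m w^T) 0 0 = (e *m v^T) 0 0 - sqnorm e.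
    by rewrite /sqnorm wE linearB /= mulmxBr mxB.
  have -> : (e *m v^T) 0 0 = (v *m e^T) 0 0.
    by rewrite -[in RHS](trmxK v) -trmx_mul [RHS]mxE.
  by rewrite v1 sqnorm_delta; field.
exists (1%:M - c *: (w^T *m w)).
  have -> : (1%:M - c *: (w^T *m w))^T = 1%:M - c *: (w^T *m w).
    by rewrite linearB /= linearZ /= trmx1 trmx_mul trmxK.
  rewrite mulmxBl mul1mx mulmxBr mulmx1 -scalemxAl -scalemxAr scalerA.
  rewrite -mulmxA (mulmxA w) wwT mul_scalar_mx -scalemxAr scalerA.
  rewrite -addrA -opprD -[RHS]subr0; congr (_ - _).
  rewrite -scalerBl -scalerDl.
  have -> : c + (c - c * c * sqnorm w) = 0 by rewrite /c; field.
  by rewrite scale0r.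
rewrite -/e mulmxBr mulmx1 -scalemxAr mulmxA ewT mul_scalar_mx scalerA.
have -> : c * (- sqnorm w / 2) = -1 by rewrite /c; field.
by rewrite scaleN1r opprK wE addrCA subrr addr0.
Qed.
End SquaredNorm.

Section SingularValueDecomposition.
Context {R : realType}.
Implicit Types m n : nat.

Definition orthogonalmx n (Q : 'M[R]_n) : Prop := Q^T *m Q = 1%:M.

Definition diag_rect m n (s : seq R) : 'M[R]_(m, n) :=
  \matrix_(i, j) (s`_i *+ (i == j :> nat)).

(* Full SVD; the sequence [s] is the diagonal of the rectangular factor. *)
Record is_svd m n (A : 'M[R]_(m, n)) (U : 'M_m) (s : seq R) (V : 'M_n) : Prop :=
  IsSVD {
    svd_orthol : orthogonalmx U;
    svd_orthor : orthogonalmx V;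
    svd_size : size s = minn m n;
    svd_sorted : sorted (fun x y => y <= x) s;
    svd_ge0 : all (fun x => 0 <= x) s;
    svd_eq : A = U *m diag_rect m n s *m V^T
  }.

Lemma diag_rect_cons m n x s :
  diag_rect (1 + m) (1 + n) (x :: s) = block_mx x%:M 0 0 (diag_rect m n s).
Proof.
apply/matrixP => i j; case: (split_ordP i) => i' ->; case: (split_ordP j) => j' ->.
- by rewrite block_mxEul !mxE (ord1 i') (ord1 j') /= ?eqxx.
- by rewrite block_mxEur !mxE (ord1 i') /=.
- by rewrite block_mxEdl !mxE (ord1 j') /=.
- by rewrite block_mxEdr !mxE /= eqSS.
Qed.

Lemma orthogonal_block n (Q : 'M[R]_n) :
  orthogonalmx Q -> orthogonalmx (block_mx 1%:M 0 0 Q : 'M_(1 + n)).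
Proof.
move=> QQ; rewrite /orthogonalmx tr_block_mx mulmx_block !trmx0 trmx1 QQ.
by rewrite !mulmx0 !mul0mx !addr0 !add0r mulmx1 -scalar_mx_block.
Qed.

Lemma orthogonalM n (P Q : 'M[R]_n) :
  orthogonalmx P -> orthogonalmx Q -> orthogonalmx (P *m Q).
Proof.
move=> PP QQ; rewrite /orthogonalmx trmx_mul mulmxA -(mulmxA Q^T) PP.
by rewrite mulmx1 QQ.
Qed.

Lemma svd_head_le m n (A : 'M[R]_(m, n)) U s V c : 0 <= c -> is_svd A U s V ->
  (forall x, sqnorm (x *m A) <= c ^+ 2 * sqnorm x) -> s`_0 <= c.
Proof.
move=> c0 [UU VV sz_s _ s_ge0 defA] Ac.
case: s => [|s0 s] //= in sz_s s_ge0 defA *.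
case/andP: s_ge0 => s0_ge0 _; rewrite -(@ler_pXn2r _ 2) ?nnegrE //.
case: m n => [|m] [|n] // in A U V UU VV sz_s defA Ac *.
have := Ac (delta_mx 0 0 *m U^T).
rewrite [X in _ * X]sqnormM ?trmxK // sqnorm_delta mulr1; apply: le_trans.
rewrite defA !mulmxA -(mulmxA _ U^T) UU mulmx1 sqnormM ?trmxK // -rowE sqnormE.
rewrite (bigD1 ord0) //= !mxE /= mulr1n lerDl sumr_ge0 // => j _.
exact: sqr_ge0.
Qed.

Lemma svd_exists m n (A : 'M[R]_(m, n)) : exists U s V, is_svd A U s V.
Proof.
elim: m n A => [|m IH] [|n] A; try by exists 1%:M, [::], 1%:M; split;
  rewrite /orthogonalmx ?trmx1 ?mulmx1 ?minn0 ?min0n //;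
  rewrite ?(flatmx0 A) ?(thinmx0 A) ?(flatmx0 (diag_rect _ _ _))
    ?(thinmx0 (diag_rect _ _ _)) ?mulmx0 ?mul0mx.
have [u u1 umax] := exists_max_sqnormM A.
have [v v1 uA] := sqnorm_normalize (u *m A).
set s := Num.sqrt _ in uA.
have s2 : sqnorm (u *m A) = s ^+ 2 by rewrite sqr_sqrtr ?sqnorm_ge0.
have [P PP eP] := orthogonal_completion u1.
have [Q QQ eQ] := orthogonal_completion v1.
pose B : 'M_(1 + m, 1 + n) := P *m A *m Q^T.
have Bmax (x : 'rV_(1 + m)) : sqnorm (x *m B) <= s ^+ 2 * sqnorm x.
  rewrite /B !mulmxA sqnormM; last by rewrite trmxK (mulmx1C QQ).
  by apply: le_trans (umax _) _; rewrite s2 sqnormM.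
have e_row k : delta_mx 0 0 = row_mx 1%:M 0 :> 'rV[R]_(1 + k).
  apply/rowP => j; case: (split_ordP j) => j' ->.
    by rewrite row_mxEl !mxE (ord1 j').
  by rewrite row_mxEr !mxE.
have eB : delta_mx 0 0 *m (P *m A *m Q^T) = s *: delta_mx 0 0 :> 'rV_n.+1.
  by rewrite 2!mulmxA eP uA -scalemxAl -eQ -mulmxA QQ mulmx1.
have Bu : usubmx B = row_mx s%:M 0.
  have -> : usubmx B = (row_mx 1%:M 0 : 'rV_(1 + m)) *m B.
    by rewrite -{2}(vsubmxK B) mul_row_col mul1mx mul0mx addr0.
  apply: etrans (_ : _ = s *: row_mx 1%:M 0) _; first by rewrite -!e_row.
  by rewrite scale_row_mx scaler0 scale_scalar_mx mulr1.
have Bur : ursubmx B = 0 by rewrite /ursubmx Bu row_mxKr.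
have Bul : ulsubmx B = s%:M by rewrite /ulsubmx Bu row_mxKl.
have Bdl : dlsubmx B = 0.
  set c := dlsubmx B.
  have := Bmax (row_mx s%:M c^T); rewrite -(submxK B) Bur Bul -/c.
  rewrite mul_row_block mulmx0 add0r !sqnorm_row_mx sqnorm_scalar.
  have -> : s%:M *m s%:M + c^T *m c = (s ^+ 2 + sqnorm c^T)%:M.
    rewrite raddfD /= -scalar_mxM expr2; congr (_ + _).
    by rewrite [LHS]mx11_scalar /sqnorm trmxK.
  rewrite sqnorm_scalar => le_s.
  suff : c^T = 0 by move/(congr1 trmx); rewrite trmxK trmx0.
  apply/sqnorm_eq0/eqP; rewrite eq_le sqnorm_ge0 andbT leNgt.
  apply/negP => c_gt0; have := sqnorm_ge0 (c^T *m drsubmx B).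
  have := sqr_ge0 s; nra.
have [U' [s' [V' svdB']]] := IH _ (drsubmx B).
have [UU VV sz_s srt_s s_ge0 defB] := svdB'.
have BE : B = block_mx 1%:M 0 0 U' *m diag_rect (1 + m) (1 + n) (s :: s')
    *m (block_mx 1%:M 0 0 V' : 'M_(1 + n))^T.
  rewrite diag_rect_cons tr_block_mx !mulmx_block !trmx0 trmx1.
  rewrite !(mulmx0, mul0mx, addr0, add0r, mulmx1, mul1mx) -defB.
  by rewrite -[LHS]submxK Bur Bul Bdl.
pose BU : 'M_m.+1 := block_mx 1%:M 0 0 U' : 'M_(1 + m).
pose BV : 'M_n.+1 := block_mx 1%:M 0 0 V' : 'M_(1 + n).
have {}BE : P *m A *m Q^T = BU *m diag_rect m.+1 n.+1 (s :: s') *m BV^T by [].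
exists (P^T *m BU), (s :: s'), (Q^T *m BV); split.
- by apply: orthogonalM; [rewrite /orthogonalmx trmxK|exact: orthogonal_block].
- by apply: orthogonalM; [rewrite /orthogonalmx trmxK|exact: orthogonal_block].
- by rewrite /= sz_s minnSS.
- have := svd_head_le (sqrtr_ge0 _ : 0 <= s) svdB' _.
  case: s' srt_s {sz_s s_ge0 defB BE svdB'} => //= s0 s' -> le_s0.
  rewrite andbT le_s0 // => x; have := Bmax (row_mx 0 x).
  rewrite -{1}(submxK B) Bur Bdl mul_row_block !mul0mx !mulmx0 !add0r.
  by rewrite !sqnorm_row_mx /sqnorm !mul0mx !mxE !add0r.
- by rewrite /= sqrtr_ge0.
rewrite trmx_mul trmxK !mulmxA -(mulmxA P^T) -(mulmxA P^T) -BE.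
by rewrite !mulmxA (mulmx1C PP) mul1mx -mulmxA (mulmx1C QQ) mulmx1.
Qed.

Lemma svd_unique m n (A : 'M[R]_(m, n)) U s V U' s' V' :
  is_svd A U s V -> is_svd A U' s' V' -> s = s'.
Proof.
move=> svdA svdA'.
have char_svd W t Z : is_svd A W t Z ->
    char_poly (A *m A^T) = \prod_(x <- [seq t`_i ^+ 2 | i <- iota 0 m]) ('X - x%:P).
  case=> WW ZZ sz_t _ _ ->; set S := diag_rect m n t.
  have -> : W *m S *m Z^T *m (W *m S *m Z^T)^T = W *m (S *m S^T) *m W^T.
    by rewrite !trmx_mul trmxK !mulmxA -(mulmxA _ Z^T) ZZ mulmx1.
  have -> : char_poly (W *m (S *m S^T) *m W^T) = char_poly (S *m S^T).
    rewrite /char_poly; set D := S *m S^T; pose fW := map_mx polyC W.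
    have fWW : fW *m fW^T = 1%:M.
      by rewrite map_trmx -map_mxM (mulmx1C WW) map_mx1.
    have -> : char_poly_mx (W *m D *m W^T) = fW *m char_poly_mx D *m fW^T.
      rewrite /char_poly_mx mulmxBr mulmxBl mul_mx_scalar -scalemxAl fWW.
      by rewrite scalemx1 /fW map_trmx -!map_mxM.
    by rewrite !det_mulmx mulrAC -det_mulmx fWW det1 mul1r.
  have SS i j : (S *m S^T) i j = t`_i ^+ 2 *+ (i == j :> nat).
    rewrite mxE; have [lt_in|le_ni] := ltnP i n.
      rewrite (bigD1 (Ordinal lt_in)) //= !mxE eqxx big1 => [|k /eqP ne].
        by rewrite addr0 /= expr2 (eq_sym (j : nat)); case: eqP => [->|_];
          rewrite ?mulr1n ?mulr0.
      rewrite !mxE; case: eqP => [eq_ik|]; last by rewrite mul0r.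
      by case: ne; apply/val_inj.
    rewrite nth_default ?sz_t ?geq_min ?le_ni ?orbT // expr0n mul0rn.
    by rewrite big1 // => k _; rewrite !mxE nth_default ?mul0rn ?mul0r //
      sz_t geq_min le_ni orbT.
  rewrite char_poly_trig; last first.
    by apply/is_trig_mxP => i j lt_ij; rewrite SS ltn_eqF.
  rewrite big_map -[X in iota _ X]subn0 -/(index_iota _ _) big_mkord.
  by apply: eq_bigr => i _; rewrite SS eqxx.
have nth_ge0 (t : seq R) i : all (fun x => 0 <= x) t -> 0 <= t`_i.
  move=> /(all_nthP 0) t_ge0; have [/t_ge0//|le_t] := ltnP i (size t).
  by rewrite nth_default.
have sorted_sq W t Z : is_svd A W t Z ->
    sorted (fun x y : R => y <= x) [seq t`_i ^+ 2 | i <- iota 0 m].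
  case=> _ _ _ /(sortedP 0) srt_t t_ge0 _; apply/(sortedP 0) => i.
  rewrite size_map size_iota => lt_im.
  rewrite !(nth_map 0%N) ?size_iota ?(ltnW lt_im) // !nth_iota ?(ltnW lt_im) //.
  rewrite !add0n ler_pXn2r ?nnegrE ?nth_ge0 //.
  have [lt_t|le_t] := ltnP i.+1 (size t); first exact: srt_t.
  by rewrite (nth_default _ le_t) nth_ge0.
have eq_sq : [seq s`_i ^+ 2 | i <- iota 0 m] = [seq s'`_i ^+ 2 | i <- iota 0 m].
  apply: (@sorted_eq _ (fun x y : R => y <= x)) (sorted_sq _ _ _ svdA)
    (sorted_sq _ _ _ svdA') _.
  - by move=> y x z le_yx le_zy; exact: le_trans le_yx.
  - by move=> x y; rewrite andbC => /le_anti.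
  - by apply: prod_XsubC_eq; rewrite -(char_svd _ _ _ svdA) (char_svd _ _ _ svdA').
have [_ _ sz_s _ s_ge0 _] := svdA; have [_ _ sz_s' _ s'_ge0 _] := svdA'.
apply: (@eq_from_nth _ 0) => [|i]; rewrite sz_s ?sz_s' // leq_min => /andP[im _].
have /(congr1 (fun t => t`_i)) := eq_sq.
rewrite !(nth_map 0%N) ?size_iota // nth_iota // add0n => /eqP.
by rewrite eqrXn2 ?nth_ge0 // => /eqP.
Qed.


Lemma singular_values_exist m n (A : 'M[R]_(m, n)) : exists s U V, is_svd A U s V.
Proof. by have [U [s [V svdA]]] := svd_exists A; exists s, U, V. Qed.

Definition singular_values m n (A : 'M[R]_(m, n)) : seq R :=
  sval (cid (singular_values_exist A)).

Lemma singular_valuesP m n (A : 'M[R]_(m, n)) U s V :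
  is_svd A U s V -> singular_values A = s.
Proof.
by rewrite /singular_values; case: cid => /= t [U' [V' svdA]] /(svd_unique svdA).
Qed.

Lemma singular_values_svd m n (A : 'M[R]_(m, n)) :
  exists U V, is_svd A U (singular_values A) V.
Proof. exact: svalP (cid (singular_values_exist A)). Qed.

(* Without a singular value gap, [U_k] depends on the choice of the full SVD,
   hence a relation between [A] and [U_k]. *)
Definition dominant_left_singular_vectors m n k
    (A : 'M[R]_(m, n)) (U_k : 'M[R]_(m, k)) : Prop :=
  exists (le_km : (k <= m)%N) U s V,
    is_svd A U s V /\ U_k = colsub (widen_ord le_km) U.

Variant schatten_exponent :=
  | SchattenFinite p of (0 < p)%N
  | SchattenInfinite.

Definition schatten_norm m n (e : schatten_exponent) (A : 'M[R]_(m, n)) : R :=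
  match e with
  | SchattenFinite p _ => (\sum_(x <- singular_values A) x ^+ p) `^ (p%:R^-1)
  | SchattenInfinite => (singular_values A)`_0
  end.

Definition norm2 m n (A : 'M[R]_(m, n)) : R := schatten_norm SchattenInfinite A.

End SingularValueDecomposition.

Section MoorePenrose.
Context {R : realType}.
Implicit Types m n : nat.

Record is_moore_penrose m n (A : 'M[R]_(m, n)) (X : 'M[R]_(n, m)) : Prop :=
  IsMoorePenrose {
    penrose_AXA : A *m X *m A = A;
    penrose_XAX : X *m A *m X = X;
    penrose_AX : (A *m X)^T = A *m X;
    penrose_XA : (X *m A)^T = X *m A
  }.

Lemma gram_unitmx m n (B : 'M[R]_(m, n)) : row_free B -> B *m B^T \in unitmx.
Proof.
move=> fB; rewrite -row_free_unit -kermx_eq0; apply/eqP/row_matrixP => i.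
rewrite row0; set x := row i _.
have : x *m (B *m B^T) = 0 by rewrite -row_mul mulmx_ker row0.
move=> xBB; apply: (row_free_inj fB); rewrite mul0mx; apply: sqnorm_eq0.
by rewrite /sqnorm trmx_mul mulmxA -(mulmxA x) xBB mul0mx mxE.
Qed.

(* For a full rank factorization A = C F, the inverse is
   F^T (F F^T)^-1 (C^T C)^-1 C^T. *)
Lemma moore_penrose_exists m n (A : 'M[R]_(m, n)) : exists X, is_moore_penrose A X.
Proof.
have [r [C [F [defA fC fF]]]] : exists r (C : 'M[R]_(m, r)) (F : 'M[R]_(r, n)),
    [/\ A = C *m F, row_free C^T & row_free F].
  exists (\rank A), (col_base A), (row_base A); split.
  - by rewrite mulmx_base.
  - by rewrite -row_leq_rank mxrank_tr col_leq_rank col_base_full.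
  - exact: row_base_free.
have uF : F *m F^T \in unitmx by exact: gram_unitmx.
have uC : C^T *m C \in unitmx by rewrite -[X in _ *m X]trmxK gram_unitmx.
pose G := invmx (F *m F^T); pose H := invmx (C^T *m C).
have GT : G^T = G by rewrite /G trmx_inv trmx_mul trmxK.
have HT : H^T = H by rewrite /H trmx_inv trmx_mul trmxK.
pose X := F^T *m G *m H *m C^T.
have AX : A *m X = C *m H *m C^T.
  by rewrite defA /X !mulmxA -(mulmxA C F) -(mulmxA C _ G) mulmxV // mulmx1.
have XA : X *m A = F^T *m G *m F.
  by rewrite defA /X !mulmxA -(mulmxA _ C^T) -(mulmxA _ H) mulVmx // mulmx1.
exists X; split; rewrite ?AX ?XA.
- by rewrite defA !mulmxA -(mulmxA _ C^T) -(mulmxA _ H) mulVmx // mulmx1.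
- by rewrite /X !mulmxA -(mulmxA _ F) -(mulmxA _ _ G) mulmxV // mulmx1.
- by rewrite !trmx_mul trmxK HT mulmxA.
- by rewrite !trmx_mul trmxK GT mulmxA.
Qed.

Definition moore_penrose m n (A : 'M[R]_(m, n)) : 'M[R]_(n, m) :=
  sval (cid (moore_penrose_exists A)).

Lemma moore_penrose_spec m n (A : 'M[R]_(m, n)) :
  is_moore_penrose A (moore_penrose A).
Proof. exact: svalP (cid (moore_penrose_exists A)). Qed.

Lemma moore_penroseP m n (A : 'M[R]_(m, n)) X :
  is_moore_penrose A X -> moore_penrose A = X.
Proof.
rewrite /moore_penrose; case: cid => /= Y [AYA YAY AYT YAT] [AXA XAX AXT XAT].
have AXY : A *m X = A *m Y.
  by rewrite -AXT -{1}AYA -(mulmxA _ A) trmx_mul AYT AXT mulmxA AXA.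
have XAY : X *m A = Y *m A.
  rewrite -XAT -{1}AYA !mulmxA -(mulmxA _ Y) trmx_mul XAT YAT.
  by rewrite mulmxA -(mulmxA Y A) -(mulmxA Y) AXA.
by rewrite -YAY -mulmxA -AXY mulmxA -XAY XAX.
Qed.

End MoorePenrose.

(* Main.v *)
Require Import Defs.
From mathcomp Require Import all_boot all_order all_algebra.
From mathcomp Require Import all_classical all_reals.
From mathcomp Require Import exp ring lra.
Set Implicit Arguments.
Unset Strict Implicit.
Unset Printing Implicit Defensive.
Import Order.TTheory GRing.Theory Num.Theory.
Local Open Scope ring_scope.

(** Write P for the orthogonal projector onto the columns of U_k and Q for the
    one onto the columns of Uhat.

    Everything about Schatten norms comes from one compression principle
    ([ell_le_diag]).  If G and H are contractions, each diagonal entry of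
    G diag(s) H is, in absolute value, at most a combination of the |s_l| with
    coefficients (G_il^2 + H_li^2) / 2, and these coefficients have row and
    column sums at most 1.  Jensen's inequality for t |-> t^p then bounds the
    l^p norm of that diagonal by the l^p norm of s, and for p infinite the
    bound is immediate.  As the singular values of M are themselves the diagonal
    of W^T M Z^T for thin singular factors W and Z of M, one gets:
    - the norm of G diag(s) H is at most the l^p norm of s, for any contractions
      G and H ([schatten_norm_factor]);
    - the triangle inequality, from Minkowski's inequality applied to the
      diagonals of W^T A Z^T and W^T B Z^T ([schatten_normD]);
    - the norm of X A is at most c times the norm of A as soon as c bounds the
      operator norm of X ([schatten_norm_mull]).

    Lower bound.  By [schatten_norm_factor], the norm of (1 - P) A is at most
    the l^p norm of the singular values of A with the first k ones erased.
    Since (1 - Q) A agrees with A on the row vectors x such that x Uhat = 0,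
    a subspace of codimension at most k, its singular values dominate those of
    A shifted by k ([nth_sv_shift], Weyl's inequality by counting dimensions).

    Upper bound.  Split (1 - Q) A = (1 - Q) (1 - P) A + (1 - Q) P A.  The first
    term is at most the norm of (1 - P) A because 1 - Q is a contraction.  For
    the second one the operator norm of (1 - Q) P must be at most eps_U.  The
    hypotheses give Uhat rank k, and for projectors with rank P <= rank Q every
    bound on (1 - P) Q is also a bound on (1 - Q) P ([op_le_proj_swap]).
    Finally (1 - P) Q = (1 - P) (Uhat - U_k) Uhat^+, because (1 - P) U_k = 0,
    and this product is visibly bounded by eps_U. *)

(** * Jensen and Minkowski inequalities for powers *)

Section Jensen.
Context {R : realType}.

(** The graph of t |-> t ^ (p+1) lies above its tangent at y; for the step,
    multiply the inequality for p by x: the defect is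
    (p+1) y^p (x - y)^2. *)
Lemma exprn_tangent (p : nat) (x y : R) : 0 <= x -> 0 <= y ->
  y ^+ p.+1 + p.+1%:R * y ^+ p * (x - y) <= x ^+ p.+1.
Proof.
move=> x0 y0; elim: p => [|p IH]; first by rewrite !expr1 expr0 mulr1; lra.
have := ler_wpM2l x0 IH; rewrite -exprS => /(le_trans _); apply.
rewrite -subr_ge0 (_ : _ - _ = p.+1%:R * y ^+ p * (x - y) ^+ 2); last first.
  by rewrite -[p.+2%:R]natr1 !exprS; ring.
by rewrite mulr_ge0 ?sqr_ge0 // mulr_ge0 ?exprn_ge0.
Qed.

(** The weights may have total mass less than 1, the missing mass being
    virtually placed at 0, where the power vanishes.  The proof averages the
    tangent inequality at the barycentre. *)
Lemma jensen_exprn (I : finType) (p : nat) (d x : I -> R) : (0 < p)%N ->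
    (forall i, 0 <= d i) -> \sum_i d i <= 1 -> (forall i, 0 <= x i) ->
  (\sum_i d i * x i) ^+ p <= \sum_i d i * x i ^+ p.
Proof.
case: p => // p _ d0 d1 x0; set y := \sum_i _.
have y0 : 0 <= y by apply: sumr_ge0 => i _; exact: mulr_ge0.
have : \sum_i d i * (y ^+ p.+1 + p.+1%:R * y ^+ p * (x i - y))
    <= \sum_i d i * x i ^+ p.+1.
  by apply: ler_sum => i _; rewrite ler_wpM2l ?exprn_tangent.
apply: le_trans.
rewrite (_ : \sum_i _ = (\sum_i d i) * (y ^+ p.+1 - p.+1%:R * y ^+ p.+1)
   + p.+1%:R * y ^+ p * y); last first.
  rewrite mulr_suml [in X in _ + X]/y mulr_sumr -big_split /=.
  by apply: eq_bigr => i _; rewrite !exprS; ring.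
rewrite -mulrA -exprSr -[p.+1%:R]natr1.
have yp0 : 0 <= y ^+ p.+1 by rewrite exprn_ge0.
have : 0 <= p%:R * y ^+ p.+1 * (1 - \sum_i d i).
  by rewrite !mulr_ge0 // subr_ge0.
lra.
Qed.

(** Minkowski's inequality, with the two norms replaced by bounds a and b so
    that no root is taken: it is Jensen for x / a and y / b with weights
    proportional to a and b. *)
Lemma exprn_sumD (I : finType) (p : nat) (x y : I -> R) a b : (0 < p)%N ->
    (forall i, 0 <= x i) -> (forall i, 0 <= y i) -> 0 <= a -> 0 <= b ->
    \sum_i x i ^+ p <= a ^+ p -> \sum_i y i ^+ p <= b ^+ p ->
  \sum_i (x i + y i) ^+ p <= (a + b) ^+ p.
Proof.
move=> p0.
(* The normalization by a and b needs them positive; a zero bound forces the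
   corresponding family to vanish. *)
have zero (z : I -> R) i : (forall i, 0 <= z i) ->
    \sum_i z i ^+ p <= 0 ^+ p -> z i = 0.
  move=> z0; rewrite expr0n gtn_eqF //= => zle.
  have /eqP : \sum_i z i ^+ p = 0.
    by apply/le_anti; rewrite zle sumr_ge0 // => j _; rewrite exprn_ge0.
  rewrite psumr_eq0 => [|j _]; last by rewrite exprn_ge0.
  by move=> /allP/(_ i); rewrite mem_index_enum expf_eq0 p0 /= => /(_ isT)/eqP.
move=> x0 y0; rewrite le_eqVlt => /predU1P[<-|a0].
  move=> b0 /(zero _ _ x0) xz yb; rewrite add0r.
  by under eq_bigr do rewrite xz add0r.
rewrite le_eqVlt => /predU1P[<-|b0].
  move=> xa /(zero _ _ y0) yz; rewrite addr0.
  by under eq_bigr do rewrite yz addr0.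
move=> xa yb; have ab0 : 0 < a + b by rewrite addr_gt0.
pose w (t : bool) := (if t then a else b) / (a + b).
have w0 t : 0 <= w t by rewrite divr_ge0 // ltW //; case: t.
have w1 : \sum_t w t <= 1 by rewrite big_bool /w /= -mulrDl divff ?gt_eqF.
rewrite -[leRHS]mulr1 -ler_pdivrMl ?exprn_gt0 // mulr_sumr.
have bound i : ((a + b) ^+ p)^-1 * (x i + y i) ^+ p
    <= w true * (x i ^+ p / a ^+ p) + w false * (y i ^+ p / b ^+ p).
  have := @jensen_exprn _ p w (fun t => if t then x i / a else y i / b)
    p0 w0 w1 _.
  rewrite !big_bool /= !expr_div_n => H.
  rewrite mulrC -expr_div_n (_ : (x i + y i) / _ = w true * (x i / a) + w false * (y i / b)).
    by apply: H => -[]; rewrite divr_ge0 // ltW.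
  by rewrite /w; field; rewrite !gt_eqF.
apply: le_trans (ler_sum _ (fun i _ => bound i)) _.
rewrite big_split /= -!mulr_sumr -!mulr_suml; apply: le_trans w1; rewrite big_bool.
by apply: lerD; rewrite ler_piMr // ler_pdivrMr ?exprn_gt0 // mul1r.
Qed.

End Jensen.

(** * The l^p norms of finite families *)

Section EllNorm.
Context {R : realType}.
Implicit Types (e : schatten_exponent).

(** A bound on the l^e norm rather than the norm itself, which avoids roots and
    treats finite and infinite exponents uniformly; meaningful for c >= 0. *)
Definition ell_le (I : finType) e (f : I -> R) (c : R) : Prop :=
  match e with
  | SchattenFinite p _ => \sum_i `|f i| ^+ p <= c ^+ p
  | SchattenInfinite => forall i, `|f i| <= c
  end.

Lemma ell_leD (I : finType) e (f g : I -> R) a b : 0 <= a -> 0 <= b ->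
  ell_le e f a -> ell_le e g b -> ell_le e (fun i => f i + g i) (a + b).
Proof.
case: e => [p p0|] /= a0 b0 fa gb; last first.
  by move=> i; apply: le_trans (ler_normD _ _) _; exact: lerD.
apply: le_trans (exprn_sumD p0 _ _ a0 b0 fa gb) => //.
by apply: ler_sum => i _; rewrite lerXn2r ?nnegrE ?addr_ge0 // ler_normD.
Qed.

Lemma ell_leZ (I : finType) e (f : I -> R) a c :
  0 <= c -> ell_le e f a -> ell_le e (fun i => c * f i) (c * a).
Proof.
case: e => [p p0|] /= c0 fa; last first.
  by move=> i; rewrite normrM (ger0_norm c0) ler_wpM2l.
under eq_bigr do rewrite normrM (ger0_norm c0) exprMn.
by rewrite -mulr_sumr exprMn ler_wpM2l ?exprn_ge0.
Qed.

(** Doubly substochastic matrices contract every l^e norm: row sums are used by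
    Jensen's inequality, column sums after exchanging the summations. *)
Lemma ell_le_mix (I J : finType) e (d : I -> J -> R) (f : I -> R) (s : J -> R) c :
    0 <= c -> (forall i j, 0 <= d i j) ->
    (forall i, \sum_j d i j <= 1) -> (forall j, \sum_i d i j <= 1) ->
    (forall i, `|f i| <= \sum_j d i j * `|s j|) ->
  ell_le e s c -> ell_le e f c.
Proof.
case: e => [p p0|] /= c0 d0 dr dc fs sc; last first.
  move=> i; apply: le_trans (fs i) _.
  apply: (@le_trans _ _ (\sum_j d i j * c)).
    by apply: ler_sum => j _; rewrite ler_wpM2l.
  by rewrite -mulr_suml ler_piMl.
apply: le_trans sc.
apply: (@le_trans _ _ (\sum_i \sum_j d i j * `|s j| ^+ p)).
  apply: ler_sum => i _; apply: le_trans (jensen_exprn p0 (d0 i) (dr i) _) => //.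
  by rewrite lerXn2r ?nnegrE // (le_trans _ (fs i)).
rewrite exchange_big /=; apply: ler_sum => j _.
by rewrite -mulr_suml ler_piMl ?exprn_ge0.
Qed.

End EllNorm.

(** * Operator norm bounds *)

Section OperatorBound.
Context {R : realType}.

(** The operator norm of M is at most |c|, M acting on row vectors. *)
Definition op_le m n (c : R) (M : 'M[R]_(m, n)) : Prop :=
  forall x : 'rV_m, sqnorm (x *m M) <= c ^+ 2 * sqnorm x.

Definition dot n (x y : 'rV[R]_n) : R := (x *m y^T) 0 0.

Lemma dotC n (x y : 'rV[R]_n) : dot x y = dot y x.
Proof. by rewrite /dot -[in RHS](trmxK y) -trmx_mul [RHS]mxE. Qed.

Lemma dot_mull m n (x : 'rV[R]_m) (y : 'rV[R]_n) (M : 'M_(m, n)) :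
  dot (x *m M) y = dot x (y *m M^T).
Proof. by rewrite /dot trmx_mul trmxK mulmxA. Qed.

Lemma sqnormBZ n (a : R) (x y : 'rV[R]_n) :
  sqnorm (x - a *: y) = sqnorm x - 2 * a * dot x y + a ^+ 2 * sqnorm y.
Proof.
rewrite !sqnormE /dot mxE !mulr_sumr -sumrB -big_split /=.
by apply: eq_bigr => i _; rewrite !mxE; ring.
Qed.

(** With x = y M^T, the squared norm of x equals the product <x M, y>, and
    expanding 0 <= |x M - c^2 y|^2 gives c^2 |x|^2 <= c^4 |y|^2; for c = 0,
    x M vanishes and the product <x M, y> already gives x = 0. *)
Lemma op_le_tr m n c (M : 'M[R]_(m, n)) : op_le c M -> op_le c M^T.
Proof.
move=> Mc y; set x := y *m M^T.
have xx : sqnorm x = dot (x *m M) y by rewrite dot_mull.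
have := sqnorm_ge0 (x *m M - c ^+ 2 *: y); rewrite sqnormBZ -xx => H.
have Mx := Mc x; have [c0|c0] := eqVneq c 0.
  have /sqnorm_eq0 xM0 : sqnorm (x *m M) = 0.
    by apply/le_anti; rewrite sqnorm_ge0 andbT; move: Mx; rewrite c0 expr0n mul0r.
  by rewrite xx xM0 /dot mul0mx mxE c0 expr0n mul0r.
have c2 : 0 < c ^+ 2 by rewrite exprn_even_gt0.
rewrite -(ler_pM2l c2); move: H Mx; set u := c ^+ 2; set s := sqnorm x.
set t := sqnorm y; set z := sqnorm _.
rewrite expr2; lra.
Qed.

Lemma op_leM m n p a b (X : 'M[R]_(m, n)) (Y : 'M[R]_(n, p)) :
  op_le a X -> op_le b Y -> op_le (a * b) (X *m Y).
Proof.
move=> Xa Yb x; rewrite mulmxA; apply: le_trans (Yb _) _.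
by rewrite exprMn (mulrC (a ^+ 2)) -[leRHS]mulrA ler_wpM2l ?sqr_ge0.
Qed.

(** Reduces general operator bounds to contractions; stated with an existential
    to include c = 0. *)
Lemma op_le_normalize m n c (X : 'M[R]_(m, n)) : op_le c X ->
  exists2 K, op_le 1 K & X = c *: K.
Proof.
move=> Xc; have [c0|c0] := eqVneq c 0.
  exists 0 => [x|]; first by rewrite mulmx0 /sqnorm mul0mx mxE expr1n mul1r sqnorm_ge0.
  rewrite scaler0; apply/row_matrixP => i; rewrite row0 rowE; apply: sqnorm_eq0.
  apply/le_anti; rewrite sqnorm_ge0 andbT; apply: le_trans (Xc _) _.
  by rewrite c0 expr0n mul0r.
exists (c^-1 *: X); last by rewrite scalerA divff ?scale1r.
move=> x; rewrite -scalemxAr sqnormZ exprVn expr1n mul1r ler_pdivrMl //.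
by rewrite exprn_even_gt0.
Qed.

Lemma op_le_isometry m n (Q : 'M[R]_(m, n)) : Q *m Q^T = 1%:M -> op_le 1 Q.
Proof. by move=> QQ x; rewrite sqnormM // expr1n mul1r. Qed.

Lemma op_le_row m n (G : 'M[R]_(m, n)) i : op_le 1 G -> \sum_j G i j ^+ 2 <= 1.
Proof.
move=> /(_ (delta_mx 0 i)); rewrite -rowE expr1n mul1r.
have -> : sqnorm (delta_mx 0 i : 'rV[R]_m) = 1.
  rewrite sqnormE (bigD1 i) //= mxE !eqxx expr1n big1 ?addr0 // => j ji.
  by rewrite mxE (negPf ji) andbF expr0n.
by rewrite sqnormE; under eq_bigr do rewrite mxE.
Qed.

Lemma op_le_col m n (G : 'M[R]_(m, n)) j : op_le 1 G -> \sum_i G i j ^+ 2 <= 1.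
Proof.
by move=> /op_le_tr/(@op_le_row _ _ _ j); under eq_bigr do rewrite mxE.
Qed.

End OperatorBound.

(** * Schatten norms through thin singular value decompositions *)

Section SchattenNorm.
Context {R : realType}.
Implicit Types (e : schatten_exponent).

(** The compression principle: by the inequality of means
    |G_il H_li| <= (G_il^2 + H_li^2) / 2, and these coefficients form a doubly
    substochastic matrix because the rows and columns of a contraction have
    norm at most 1. *)
Lemma ell_le_diag e m r (G : 'M[R]_(m, r)) (H : 'M[R]_(r, m)) (s : 'rV_r) c :
    0 <= c -> op_le 1 G -> op_le 1 H -> ell_le e (s 0) c ->
  ell_le e (fun i => (G *m diag_mx s *m H) i i) c.
Proof.
move=> c0 G1 H1.
apply: (@ell_le_mix _ _ _ _ (fun i l => (G i l ^+ 2 + H l i ^+ 2) / 2)) => //.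
- by move=> i l; rewrite divr_ge0 // addr_ge0 ?sqr_ge0.
- move=> i; rewrite -mulr_suml big_split /=.
  by have := op_le_row i G1; have := op_le_col i H1; lra.
- move=> l; rewrite -mulr_suml big_split /=.
  by have := op_le_col l G1; have := op_le_row l H1; lra.
move=> i; rewrite mxE; apply: le_trans (ler_norm_sum _ _ _) _.
apply: ler_sum => l _; rewrite mul_mx_diag mxE !normrM mulrAC ler_wpM2r //.
rewrite -(real_normK (num_real (G i l))) -(real_normK (num_real (H l i))).
by have := sqr_ge0 (`|G i l| - `|H l i|); nra.
Qed.

Definition sv m n (A : 'M[R]_(m, n)) : 'rV_(minn m n) :=
  \row_i (singular_values A)`_i.

Lemma size_sv m n (A : 'M[R]_(m, n)) : size (singular_values A) = minn m n.
Proof. by have [U [V []]] := singular_values_svd A. Qed.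

Lemma nth_sv_ge0 m n (A : 'M[R]_(m, n)) i : 0 <= (singular_values A)`_i.
Proof.
have [U [V [_ _ _ _ /(all_nthP 0) s0 _]]] := singular_values_svd A.
by have [/s0//|le_i] := ltnP i (size (singular_values A)); rewrite nth_default.
Qed.

Lemma nth_sv_anti m n (A : 'M[R]_(m, n)) i j : (i <= j)%N ->
  (singular_values A)`_j <= (singular_values A)`_i.
Proof.
move=> ij; have [jr|rj] := ltnP j (size (singular_values A)); last first.
  by rewrite (nth_default _ rj) nth_sv_ge0.
have [U [V [_ _ _ srt _ _]]] := singular_values_svd A.
by apply: (sorted_leq_nth _ _ _ srt) => //; [move=> y x z yx zy; exact: le_trans yx
  |rewrite inE (leq_ltn_trans ij)].
Qed.

Lemma schatten_norm_ge0 e m n (A : 'M[R]_(m, n)) : 0 <= schatten_norm e A.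
Proof. by case: e => [p p0|] /=; rewrite ?powR_ge0 ?nth_sv_ge0. Qed.

Lemma ell_le_sv e m n (A : 'M[R]_(m, n)) c : 0 <= c ->
  ell_le e (sv A 0) c <-> schatten_norm e A <= c.
Proof.
case: e => [p p0|] /= c0; last first.
  split=> [H|H i]; last first.
    rewrite mxE ger0_norm ?nth_sv_ge0 //; apply: le_trans H; exact: nth_sv_anti.
  case: (posnP (minn m n)) => [r0|r0]; first by rewrite nth_default // size_sv r0.
  by have := H (Ordinal r0); rewrite mxE ger0_norm ?nth_sv_ge0.
rewrite (big_nth 0) size_sv big_mkord.
under eq_bigr do rewrite mxE ger0_norm ?nth_sv_ge0 //.
set S := \sum_i _; have S0 : 0 <= S.
  by apply: sumr_ge0 => i _; rewrite exprn_ge0 ?nth_sv_ge0.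
have powK : (S `^ p%:R^-1) ^+ p = S.
  by rewrite -powR_mulrn ?powR_ge0 // -powRrM mulVf ?powRr1 // pnatr_eq0 -lt0n.
by rewrite -(@ler_pXn2r _ p p0 (S `^ _)) ?nnegrE ?powR_ge0 // powK.
Qed.

Lemma orthonormal_colsub m k (f : 'I_k -> 'I_m) (Q : 'M[R]_m) :
  injective f -> orthogonalmx Q -> (colsub f Q)^T *m colsub f Q = 1%:M.
Proof.
move=> fI QQ; apply/matrixP => i j; have /matrixP/(_ (f i) (f j)) := QQ.
rewrite !mxE (inj_eq fI) => <-.
by apply: eq_bigr => a _; rewrite !mxE.
Qed.

Lemma widen_ord_inj m n (le_mn : (m <= n)%N) : injective (widen_ord le_mn).
Proof. by move=> i j [] /val_inj. Qed.

(** The left factor consists of columns of the given U, which is what relates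
    this decomposition to dominant singular vectors taken from the same U. *)
Lemma thin_svd m n (A : 'M[R]_(m, n)) U V (r := minn m n) :
    is_svd A U (singular_values A) V ->
  let W := colsub (widen_ord (geq_minl m n)) U in
  exists Z : 'M_(r, n), [/\ W^T *m W = 1%:M, Z *m Z^T = 1%:M
    & A = W *m diag_mx (sv A) *m Z].
Proof.
case=> UU VV _ _ _ defA W; pose w := widen_ord (geq_minl m n).
pose z := widen_ord (geq_minr m n).
exists (colsub z V)^T; split; rewrite ?trmxK;
  [by apply: orthonormal_colsub => //; exact: widen_ord_inj..|].
have DE : diag_rect m n (singular_values A)
    = colsub w 1%:M *m diag_mx (sv A) *m (colsub z 1%:M)^T.
  apply/matrixP => i j; rewrite mxE [RHS]mxE.
  have [ir|ri] := ltnP i (minn m n); last first.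
    rewrite nth_default ?size_sv // mul0rn big1 // => l _.
    rewrite mul_mx_diag !mxE; case: eqP => [il|]; last by rewrite !mul0r.
    by move: ri; rewrite il /= leqNgt ltn_ord.
  rewrite (bigD1 (Ordinal ir)) //= big1 ?addr0 => [|l li]; last first.
    rewrite mul_mx_diag !mxE; case: eqP => [il|]; last by rewrite !mul0r.
    by case/eqP: li; apply/val_inj; have /(congr1 val) := il.
  rewrite mul_mx_diag !mxE -(inj_eq val_inj) /= eqxx mul1r.
  by rewrite -(inj_eq val_inj) /= eq_sym mulr_natr.

by rewrite [LHS]defA DE /W !mulmxA mulmx_colsub mulmx1 -!mulmxA -trmx_mul mulmx_colsub mulmx1.
Qed.


Lemma thin_svd_exists m n (A : 'M[R]_(m, n)) (r := minn m n) :
  exists (W : 'M_(m, r)) (Z : 'M_(r, n)), [/\ W^T *m W = 1%:M, Z *m Z^T = 1%:M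
    & A = W *m diag_mx (sv A) *m Z].
Proof.
have [U [V svdA]] := singular_values_svd A.
by have [Z WZ] := thin_svd svdA; eexists; exists Z; exact: WZ.
Qed.

Lemma op_le_orthonormal m r (W : 'M[R]_(m, r)) : W^T *m W = 1%:M -> op_le 1 W.
Proof.
by move=> WW; rewrite -(trmxK W); apply/op_le_tr/op_le_isometry; rewrite trmxK.
Qed.

Lemma orthonormal_compress m n r (W : 'M[R]_(m, r)) (D : 'M[R]_r)
    (Z : 'M[R]_(r, n)) : W^T *m W = 1%:M -> Z *m Z^T = 1%:M ->
  W^T *m (W *m D *m Z) *m Z^T = D.
Proof. by move=> WW ZZ; rewrite !mulmxA WW mul1mx -mulmxA ZZ mulmx1. Qed.

(** The factorization need not be a singular value decomposition: compressing it
    by the singular vectors of the product yields the singular values as the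
    diagonal of (W^T G) diag(s) (H Z^T), whose outer factors are again
    contractions. *)
Lemma schatten_norm_factor e m n r (G : 'M[R]_(m, r)) (H : 'M[R]_(r, n))
    (s : 'rV_r) c :
    0 <= c -> op_le 1 G -> op_le 1 H -> ell_le e (s 0) c ->
  schatten_norm e (G *m diag_mx s *m H) <= c.
Proof.
move=> c0 G1 H1 sc; set M := _ *m H.
have [W [Z [WW ZZ defM]]] := thin_svd_exists M.
apply/ell_le_sv => //.
have -> : sv M 0 = (fun i => ((W^T *m G) *m diag_mx s *m (H *m Z^T)) i i).
  apply/funext => i.
  have -> : (W^T *m G) *m diag_mx s *m (H *m Z^T) = W^T *m M *m Z^T.
    by rewrite /M !mulmxA.
  by rewrite [in RHS]defM orthonormal_compress // [RHS]mxE eqxx mulr1n.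
have W1 : op_le 1 W^T by apply/op_le_tr/op_le_orthonormal.
have Z1 : op_le 1 Z^T by apply/op_le_tr/op_le_isometry.
by apply: ell_le_diag => //; rewrite -[X in op_le X _](mulr1 1); exact: op_leM.
Qed.

Lemma schatten_norm_sv e m n (A : 'M[R]_(m, n)) :
  ell_le e (sv A 0) (schatten_norm e A).
Proof. by apply/ell_le_sv; rewrite ?schatten_norm_ge0. Qed.

(** Compressing by the singular vectors of A + B turns its singular values into
    the sum of two diagonals, bounded by the norms of A and of B. *)
Lemma schatten_normD e m n (A B : 'M[R]_(m, n)) :
  schatten_norm e (A + B) <= schatten_norm e A + schatten_norm e B.
Proof.
apply/ell_le_sv; first by rewrite addr_ge0 ?schatten_norm_ge0.
have [W [Z [WW ZZ defAB]]] := thin_svd_exists (A + B).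
have -> : sv (A + B) 0
    = (fun i => (W^T *m A *m Z^T) i i + (W^T *m B *m Z^T) i i).
  apply/funext => i; transitivity ((W^T *m (A + B) *m Z^T) i i).
    by rewrite [in RHS]defAB orthonormal_compress // [RHS]mxE eqxx mulr1n.
  by rewrite mulmxDr mulmxDl mxE.
have W1 : op_le 1 W^T by apply/op_le_tr/op_le_orthonormal.
have Z1 : op_le 1 Z^T by apply/op_le_tr/op_le_isometry.
have compress (C : 'M[R]_(m, n)) :
    ell_le e (fun i => (W^T *m C *m Z^T) i i) (schatten_norm e C).
  have [W' [Z' [WW' ZZ' {1}->]]] := thin_svd_exists C.
  rewrite !mulmxA -mulmxA; apply: ell_le_diag (schatten_norm_ge0 _ _) _ _
    (schatten_norm_sv _ _); rewrite -[X in op_le X _](mulr1 1).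
    by apply: op_leM => //; exact: op_le_orthonormal.
  by apply: op_leM => //; exact: op_le_isometry.
by apply: ell_leD; rewrite ?schatten_norm_ge0.
Qed.

Lemma schatten_norm_mull e l m n (X : 'M[R]_(l, m)) (A : 'M[R]_(m, n)) c :
  0 <= c -> op_le c X -> schatten_norm e (X *m A) <= c * schatten_norm e A.
Proof.
move=> c0 /op_le_normalize[K K1 ->].
have [W [Z [WW ZZ {1}->]]] := thin_svd_exists A.
have -> : (c *: K) *m (W *m diag_mx (sv A) *m Z)
    = (K *m W) *m diag_mx (c *: sv A) *m Z.
  by rewrite linearZ /= -scalemxAr -!scalemxAl !mulmxA.
apply: schatten_norm_factor.
- by rewrite mulr_ge0 ?schatten_norm_ge0.
- by rewrite -[X in op_le X _](mulr1 1); apply: op_leM => //;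
    exact: op_le_orthonormal.
- exact: op_le_isometry.
rewrite (_ : (c *: sv A) 0 = fun i => c * sv A 0 i).
  exact/ell_leZ/schatten_norm_sv.
by apply/funext => i; rewrite mxE.
Qed.

Lemma sqnorm_mul_svd m n r (W : 'M[R]_(m, r)) s (Z : 'M[R]_(r, n)) (x : 'rV_m) :
    Z *m Z^T = 1%:M ->
  sqnorm (x *m (W *m diag_mx s *m Z)) = \sum_l s 0 l ^+ 2 * (x *m W) 0 l ^+ 2.
Proof.
move=> ZZ; rewrite !mulmxA sqnormM // sqnormE; apply: eq_bigr => l _.
by rewrite mul_mx_diag mxE exprMn mulrC.
Qed.

(** On the orthogonal complement of the first j left singular vectors, the j-th
    singular value (counted from 0) bounds A; j = 0 is the operator norm. *)
Lemma sqnorm_mul_le m n (A : 'M[R]_(m, n)) W (Z : 'M_(minn m n, n)) (x : 'rV_m) j :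
    W^T *m W = 1%:M -> Z *m Z^T = 1%:M -> A = W *m diag_mx (sv A) *m Z ->
    (forall l : 'I_(minn m n), (l < j)%N -> (x *m W) 0 l = 0) ->
  sqnorm (x *m A) <= (singular_values A)`_j ^+ 2 * sqnorm x.
Proof.
move=> WW ZZ defA xW0; have := op_le_orthonormal WW x.
rewrite expr1n mul1r => xWx; apply: le_trans (ler_wpM2l (sqr_ge0 _) xWx).
rewrite {1}defA sqnorm_mul_svd // sqnormE mulr_sumr; apply: ler_sum => l _.
have [/xW0->|jl] := ltnP l j; first by rewrite expr0n !mulr0.
by rewrite ler_wpM2r ?sqr_ge0 // mxE lerXn2r ?nnegrE ?nth_sv_ge0 ?nth_sv_anti.
Qed.

Lemma op_le_norm2 m n (A : 'M[R]_(m, n)) : op_le (norm2 A) A.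
Proof.
by move=> x; have [W [Z [WW ZZ defA]]] := thin_svd_exists A;
  exact: (sqnorm_mul_le WW ZZ defA).
Qed.

(** Weyl's inequality.  With q = j + k, some nonzero x in the span of the first
    q + 1 left singular vectors of A satisfies the k equations x Y = 0 and the
    j equations of orthogonality to the first j left singular vectors of E; on
    this x, s_q(A) |x| <= |x A| = |x E| <= s_j(E) |x|. *)
Lemma nth_sv_shift m n k (A E : 'M[R]_(m, n)) (Y : 'M[R]_(m, k)) :
    (forall x : 'rV_m, x *m Y = 0 -> x *m A = x *m E) ->
  forall j, (singular_values A)`_(j + k) <= (singular_values E)`_j.
Proof.
move=> AE j; have [qr|] := ltnP (j + k) (minn m n); last first.
  by move=> rq; rewrite nth_default ?nth_sv_ge0 // size_sv.
have jr : (j <= minn m n)%N by rewrite (leq_trans (leq_addr k j)) // ltnW.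
have [W [Z [WW ZZ defA]]] := thin_svd_exists A.
have [W' [Z' [WW' ZZ' defE]]] := thin_svd_exists E.
(* The vector x is y D W^T, with y in the kernel of the matrix N of the j + k
   linear constraints. *)
pose D : 'M[R]_((j + k).+1, minn m n) := pid_mx (j + k).+1.
pose N := row_mx (D *m W^T *m Y) (colsub (widen_ord jr) (D *m W^T *m W')).
have /rowV0Pn[y /sub_kermxP] : kermx N != 0.
  by rewrite kermx_eq0 -row_leq_rank -ltnNge (leq_ltn_trans (rank_leq_col N)) // addnC.
rewrite mul_mx_row mulmx_colsub -[0]row_mx0 => /eq_row_mx[]; rewrite !mulmxA.
set x := y *m D *m W^T => /AE xAE xW' y0.
have xW : x *m W = y *m D by rewrite -mulmxA WW mulmx1.
have x_gt0 : 0 < sqnorm x.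
  rewrite lt_def sqnorm_ge0 andbT sqnormM ?trmxK //.
  apply: contra_neq y0 => /sqnorm_eq0 yD0.
  have /row_free_inj : row_free D by rewrite /row_free rank_pid_mx.
  by apply; rewrite yD0 mul0mx.
rewrite -(@ler_pXn2r _ 2) ?nnegrE ?nth_sv_ge0 // -(ler_pM2r x_gt0).
have xE : sqnorm (x *m E) <= (singular_values E)`_j ^+ 2 * sqnorm x.
  apply: (sqnorm_mul_le WW' ZZ' defE) => l lj.
  have /rowP/(_ (Ordinal lj)) := xW'; rewrite mxE [RHS]mxE => <-.
  by congr ((x *m W') _ _); exact: val_inj.
apply: le_trans xE; rewrite -xAE {2}defA sqnorm_mul_svd //.
rewrite sqnormM ?trmxK // -xW sqnormE mulr_sumr; apply: ler_sum => l _.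
have [lq|ql] := leqP l (j + k).
  by rewrite ler_wpM2r ?sqr_ge0 // mxE lerXn2r ?nnegrE ?nth_sv_ge0 ?nth_sv_anti.
rewrite xW (_ : (y *m D) 0 l = 0) ?expr0n ?mulr0 // mxE big1 // => i _.
by rewrite mxE ltn_eqF ?mulr0 // (leq_trans (ltn_ord i)).
Qed.

End SchattenNorm.

(** * Orthogonal projectors of comparable ranks *)

Section Projectors.
Context {R : realType}.

Definition is_projector m (P : 'M[R]_m) : Prop := P^T = P /\ P *m P = P.

Lemma sqnorm_proj m (P : 'M[R]_m) (x : 'rV_m) :
  is_projector P -> sqnorm (x *m P) = dot (x *m P) x.
Proof. by case=> PT PP; rewrite /sqnorm /dot trmx_mul PT !mulmxA -(mulmxA x) PP. Qed.

Lemma sqnorm_projC m (P : 'M[R]_m) (x : 'rV_m) :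
  is_projector P -> sqnorm (x *m (1%:M - P)) = sqnorm x - sqnorm (x *m P).
Proof.
move=> projP; rewrite mulmxBr mulmx1 -[X in _ - X]scale1r sqnormBZ.
by rewrite dotC -sqnorm_proj //; ring.
Qed.

Lemma op_le_proj m (P : 'M[R]_m) : is_projector P -> op_le 1 P.
Proof.
move=> projP x; rewrite expr1n mul1r -subr_ge0 -sqnorm_projC //.
exact: sqnorm_ge0.
Qed.

Lemma op_le_projC m (P : 'M[R]_m) : is_projector P -> op_le 1 (1%:M - P).
Proof.
by move=> projP x; rewrite expr1n mul1r sqnorm_projC // gerBl sqnorm_ge0.
Qed.

(** If c^2 >= 1 the conclusion holds for any projectors.  Otherwise
    |x P|^2 >= (1 - c^2) |x|^2 for x in the range of Q, so P is injective there,
    hence maps it onto its own range by the rank condition.  Any z P is thus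
    x P for some x in the range of Q, and <z P Q, x> = <z P, x> = |z P|^2; then
    Cauchy-Schwarz gives |z P Q|^2 >= (1 - c^2) |z P|^2. *)
Lemma op_le_proj_swap m (P Q : 'M[R]_m) c :
    is_projector P -> is_projector Q -> (\rank P <= \rank Q)%N ->
  op_le c ((1%:M - P) *m Q) -> op_le c ((1%:M - Q) *m P).
Proof.
move=> projP projQ rPQ; have [[PT PP] [QT QQ]] := (projP, projQ).
have [c1|c1] := leP 1 (c ^+ 2).
  move=> _ x; have := op_leM (op_le_projC projQ) (op_le_proj projP) x.
  rewrite mulr1 expr1n mul1r => /le_trans; apply.
  by rewrite ler_peMl ?sqnorm_ge0.
have trC (S T : 'M[R]_m) : S^T = S -> T^T = T ->
    ((1%:M - S) *m T)^T = T *m (1%:M - S).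
  by move=> ST TT; rewrite trmx_mul linearB /= trmx1 ST TT.
move=> /op_le_tr; rewrite trC // => PQc.
rewrite -[_ *m P]trmxK; apply: op_le_tr; rewrite trC // => z.
have lowP (u : 'rV_m) : (1 - c ^+ 2) * sqnorm (u *m Q) <= sqnorm (u *m Q *m P).
  have := PQc (u *m Q); rewrite mulmxA -(mulmxA u) QQ sqnorm_projC //; lra.
have rQP : \rank (Q *m P) = \rank Q.
  apply/mxrank_injP/rowV0P => v; rewrite sub_capmx => /andP[/submxP[u ->]].
  move/sub_kermxP => uQP0; have := lowP u; rewrite uQP0.
  rewrite [X in _ <= X]/sqnorm mul0mx mxE pmulr_rle0 ?subr_gt0 // => uQ0.
  by apply: sqnorm_eq0; apply/le_anti; rewrite uQ0 sqnorm_ge0.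
have : (z *m P <= Q *m P)%MS.
  apply: submx_trans (submxMl z P) _.
  by rewrite -(geq_leqif (mxrank_leqif_sup (submxMl Q P))) rQP.
case/submxP => u; rewrite !mulmxA => zP.
have zPx : dot (z *m P *m Q) (u *m Q) = sqnorm (z *m P).
  by rewrite dot_mull QT -(mulmxA u) QQ zP -sqnorm_proj.
(* Cauchy-Schwarz in the form of the nonnegativity of a square, the factor
   1 - c^2 being the one given by the lower bound lowP. *)
have := sqnorm_ge0 (z *m P *m Q - (1 - c ^+ 2) *: (u *m Q)).
rewrite sqnormBZ zPx sqnorm_projC //.
have := lowP u; rewrite -zP.
have := op_le_proj projP z; rewrite expr1n mul1r.
move: (sqnorm_ge0 (z *m P)) c1 (sqr_ge0 c).
move: (sqnorm (z *m P)) (sqnorm z) (sqnorm (z *m P *m Q)) (sqnorm (u *m Q)).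
move: (c ^+ 2) => d g h a b g0 d1 d0 gh db.
have := ler_wpM2l d0 gh; have : 0 <= 1 - d by lra.
move=> /ler_wpM2l/(_ _ _ db); rewrite expr2; nra.
Qed.

Lemma moore_penrose_proj m n (A : 'M[R]_(m, n)) :
  is_projector (A *m moore_penrose A).
Proof.
have [AXA XAX AXT XAT] := moore_penrose_spec A.
by split=> //; rewrite mulmxA AXA.
Qed.

Lemma orthonormal_proj m k (U : 'M[R]_(m, k)) :
  U^T *m U = 1%:M -> is_projector (U *m U^T).
Proof.
by move=> UU; split; rewrite ?trmx_mul ?trmxK // mulmxA -(mulmxA U) UU mulmx1.
Qed.

(** A row vector y such that y V^T = 0 satisfies |y| = |y (U - V)^T| <= |y| / 2. *)
Lemma rank_near_orthonormal m k (U V : 'M[R]_(m, k)) :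
  U^T *m U = 1%:M -> norm2 (U - V) <= 1 / 2 -> \rank V = k.
Proof.
move=> UU UV2; rewrite -mxrank_tr; apply/eqP; rewrite -/(row_free _) -kermx_eq0.
apply/rowV0P => y /sub_kermxP yV; have := op_le_tr (op_le_norm2 (U - V)) y.
rewrite linearB /= mulmxBr yV subr0 sqnormM ?trmxK // => y2.
apply: sqnorm_eq0; apply/le_anti; rewrite sqnorm_ge0 andbT.
have := sqnorm_ge0 y; have : 0 <= norm2 (U - V) := schatten_norm_ge0 _ _.
have: norm2 (U - V) ^+ 2 <= 1 / 4 by have : 0 <= norm2 (U - V) := schatten_norm_ge0 _ _; nra.
nra.
Qed.

End Projectors.

(** * Deflation by dominant left singular vectors *)

Section Deflation.
Context {R : realType}.

(** Applying 1 - U_k U_k^T erases the first k entries of the diagonal factor of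
    the thin decomposition of A; the result is not sorted, hence the use of
    [schatten_norm_factor] instead of the singular values of the product. *)
Lemma schatten_norm_tail_le e m n k (A : 'M[R]_(m, n))
    (U_k : 'M[R]_(m, k)) c : 0 <= c ->
    dominant_left_singular_vectors A U_k ->
    ell_le e (fun l : 'I_(minn m n) => if (l < k)%N then 0 else sv A 0 l) c ->
  schatten_norm e ((1%:M - U_k *m U_k^T) *m A) <= c.
Proof.
move=> c0 [km [U [s [V [svdA ->]]]]]; have sE := singular_valuesP svdA.
rewrite -sE in svdA => {s sE}; have [UU _ _ _ _ _] := svdA.
have [Z [WW ZZ defA]] := thin_svd svdA; set W := colsub _ U in WW defA.
set Uk := colsub _ U => tc; pose t := \row_(l < minn m n) (if (l < k)%N then 0 else sv A 0 l).
have UkW i l : (Uk^T *m W) i l = (i == l :> nat)%:R.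
  have /matrixP/(_ (widen_ord km i) (widen_ord (geq_minl m n) l)) := UU.
  rewrite !mxE -(inj_eq val_inj) /= => <-.
  by apply: eq_bigr => a _; rewrite !mxE.
have -> : (1%:M - Uk *m Uk^T) *m A = W *m diag_mx t *m Z.
  rewrite {1}defA !mulmxA; congr (_ *m Z).
  rewrite mulmxBl mul1mx -(mulmxA Uk); apply/matrixP => a l.
  have UkUkW : (Uk *m (Uk^T *m W)) a l = if (l < k)%N then W a l else 0.
    rewrite mxE; under eq_bigr do rewrite UkW.
    have [lk|kl] := ltnP l k; last first.
      by rewrite big1 // => i _; rewrite ltn_eqF ?mulr0 // (leq_trans (ltn_ord i)).
    rewrite (bigD1 (Ordinal lk)) //= eqxx mulr1 big1 ?addr0 => [|i il].
      by rewrite !mxE; congr (U _ _); exact: val_inj.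
    by rewrite (_ : (i == l :> nat) = false) ?mulr0 // -(negPf il).
  rewrite !mul_mx_diag [LHS]mxE [RHS]mxE [X in X * _]mxE [X in _ + X]mxE UkUkW.
  rewrite [t 0 l]mxE; case: ifP => _; first by rewrite subrr mul0r mulr0.
  by rewrite subr0.
apply: schatten_norm_factor => //; [exact: op_le_orthonormal|exact: op_le_isometry|].
by rewrite (_ : t 0 = fun l => if (l < k)%N then 0 else sv A 0 l) //;
  apply/funext => l; rewrite mxE.
Qed.

(** The lower bound for 1 - V X with arbitrary V and X: the product V X has rank
    at most k, which is all that Weyl's inequality needs. *)
Lemma schatten_norm_dominant_min e m n k (A : 'M[R]_(m, n)) (U_k V : 'M[R]_(m, k)) X :
    dominant_left_singular_vectors A U_k ->
  schatten_norm e ((1%:M - U_k *m U_k^T) *m A)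
    <= schatten_norm e ((1%:M - V *m X) *m A).
Proof.
move=> domA; set E := (1%:M - V *m X) *m A.
have shift : forall j, (singular_values A)`_(j + k) <= (singular_values E)`_j.
  apply: (@nth_sv_shift _ _ _ _ _ _ V) => x xV.
  by rewrite /E mulmxA mulmxBr mulmx1 mulmxA xV mul0mx subr0.
apply: schatten_norm_tail_le (schatten_norm_ge0 _ _) domA _.
(* The erased family is dominated by the singular values of E moved k places
   up: the moving is done by a partial permutation matrix. *)
apply: (@ell_le_mix _ _ _ _ (fun i j : 'I_(minn m n) => (i == j + k :> nat)%N%:R))
  (schatten_norm_sv _ _); rewrite ?schatten_norm_ge0 //.
- move=> i; have [ik|ki] := ltnP i k.
    by rewrite big1 // => j _; rewrite ltn_eqF // (leq_trans ik) ?leq_addl.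
  have ir : (i - k < minn m n)%N by rewrite (leq_ltn_trans (leq_subr _ _)).
  rewrite (bigD1 (Ordinal ir)) //= subnK // eqxx big1 ?addr0 // => j jk.
  case: eqP => // ij; case/eqP: jk; apply/val_inj => /=.
  by rewrite ij addnK.
- move=> j; have [jr|rj] := ltnP (j + k) (minn m n); last first.
    by rewrite big1 // => i _; rewrite ltn_eqF // (leq_trans (ltn_ord i)).
  rewrite (bigD1 (Ordinal jr)) //= eqxx big1 ?addr0 // => i ij.
  by case: eqP => // ij'; case/eqP: ij; apply/val_inj.
move=> i; have [ik|ki] := ltnP i k.
  by rewrite normr0 sumr_ge0 // => j _; rewrite mulr_ge0.
have ir : (i - k < minn m n)%N by rewrite (leq_ltn_trans (leq_subr _ _)).
rewrite (bigD1 (Ordinal ir)) //= subnK // eqxx mul1r !mxE !ger0_norm ?nth_sv_ge0 //.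
have := shift (i - k)%N; rewrite subnK // => /le_trans; apply.
by rewrite lerDl sumr_ge0 // => j _; rewrite mulr_ge0.
Qed.

End Deflation.

Theorem corollary1 (R : realType) (m n k : nat) (A : 'M[R]_(m, n))
    (U_k Uhat : 'M[R]_(m, k)) :
  (1 <= k)%N -> (k <= \rank A)%N ->
  dominant_left_singular_vectors A U_k ->
  \rank Uhat = k \/ norm2 (U_k - Uhat) <= 1 / 2 ->
  let eps_U := norm2 (moore_penrose Uhat) * norm2 (U_k - Uhat) in
  forall p : schatten_exponent,
    schatten_norm p ((1%:M - U_k *m U_k^T) *m A)
      <= schatten_norm p ((1%:M - Uhat *m moore_penrose Uhat) *m A)
    /\
    schatten_norm p ((1%:M - Uhat *m moore_penrose Uhat) *m A)
      <= schatten_norm p ((1%:M - U_k *m U_k^T) *m A)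
         + eps_U * schatten_norm p A.
Proof.
move=> _ _ domA rkU eps p; split; first exact: schatten_norm_dominant_min.
have UU : U_k^T *m U_k = 1%:M.
  have [km [U [s [V [[UU _ _ _ _ _] ->]]]]] := domA.
  by apply: orthonormal_colsub => //; exact: widen_ord_inj.
have {}rkU : \rank Uhat = k by case: rkU => // /(rank_near_orthonormal UU).
have eps0 : 0 <= eps by rewrite mulr_ge0 ?(schatten_norm_ge0 SchattenInfinite).
have projP := orthonormal_proj UU; have projQ := moore_penrose_proj Uhat.
set P := U_k *m U_k^T in projP *; set Q := Uhat *m _ in projQ *.
have QP : op_le eps ((1%:M - Q) *m P).
  apply: op_le_proj_swap => //.
    apply: leq_trans (mxrankM_maxl _ _) _.
    rewrite (leq_trans (rank_leq_col _)) // -{1}rkU.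
    have [AXA _ _ _] := moore_penrose_spec Uhat.
    by rewrite -{1}AXA mxrankM_maxl.
  have -> : (1%:M - P) *m Q
      = (1%:M - P) *m ((Uhat - U_k) *m moore_penrose Uhat).
    have PU : (1%:M - P) *m U_k = 0.
      by rewrite mulmxBl mul1mx -mulmxA UU mulmx1 subrr.
    by rewrite [RHS]mulmxA [X in _ = X *m _]mulmxBr PU subr0 -mulmxA.
  rewrite -[eps]mul1r [eps]mulrC; apply: op_leM (op_le_projC projP) _.
  apply: op_leM (op_le_norm2 _) => x.
  by rewrite -(opprB U_k) mulmxN -scaleN1r sqnormZ sqrrN expr1n mul1r; exact: op_le_norm2.
have -> : (1%:M - Q) *m A
    = (1%:M - Q) *m ((1%:M - P) *m A) + (1%:M - Q) *m P *m A.
  by rewrite -mulmxA -mulmxDr -mulmxDl subrK mul1mx.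
apply: le_trans (schatten_normD _ _ _) _; apply: lerD.
  by rewrite -[leRHS]mul1r; apply: schatten_norm_mull => //; exact: op_le_projC.
exact: schatten_norm_mull.
Qed.
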